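(* The projective simulability threshold of the Hesse SIC-POVM $\mathbf{E}_{\mathrm{Hesse}}$ on $\mathbb{C}^3$ is $$v^*(\mathbf{E}_{\mathrm{Hesse}})=\frac16\left(1+4\cos\left(\frac{\pi}{9}\right)\right).$$
   Context: An $n$-outcome POVM on $\mathbb{C}^d$ is a tuple $\{E_a\}_{a=1}^n$ of positive semidefinite $d\times d$ complex matrices with $\sum_a E_a=\mathbb{1}$. An $n$-outcome projective measurement is a POVM all of whose elements are orthogonal projections (some possibly zero). A POVM $\{E_a\}_{a=1}^n$ is projectively simulable if there are a finite probability distribution $\{q_\lambda\}_\lambda$ and $n$-outcome projective measurements $\{P_{a|\lambda}\}_{a=1}^n$ on $\mathbb{C}^d$ with $E_a=\sum_\lambda q_\lambda P_{a|\lambda}$ for all $a$. For $v\in[0,1]$ the depolarising map is $\Phi_v(X)=vX+\frac{1-v}{d}\operatorname{tr}(X)\mathbb{1}$. The projective simulability threshold of $\mathbf{E}=\{E_a\}_a$ is $v^*(\mathbf{E})=\max\{v\in[0,1] : \{\Phi_v(E_a)\}_a \text{ is projectively simulable}\}$. The Hesse SIC-POVM is the nine-outcome POVM on $\mathbb{C}^3$ with elements $E_a=\frac13|\psi_a\rangle\langle\psi_a|$, $a=1,\dots,9$, where $\psi_a$ is $\frac{1}{\sqrt2}$ times the $a$-th column of $$\begin{pmatrix}0&0&0&-1&-\omega^2&-\omega&1&\omega&\omega^2\\ 1&\omega&\omega^2&0&0&0&-1&-\omega^2&-\omega\\ -1&-\omega^2&-\omega&1&\omega&\omega^2&0&0&0\end{pmatrix},\qquad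 \omega=e^{2\pi i/3}.$$ *)

(* Defs.v *)
From HB Require Import structures.
From mathcomp Require Import all_boot all_order all_algebra.
From mathcomp Require Import sesquilinear spectral.
From mathcomp Require Import all_classical all_reals all_analysis.
From mathcomp Require Import complex.

Set Implicit Arguments.
Unset Strict Implicit.
Unset Printing Implicit Defensive.

Import Order.TTheory GRing.Theory Num.Theory.
Local Open Scope classical_set_scope.
Local Open Scope ring_scope.
Local Open Scope sesquilinear_scope.
Local Open Scope complex_scope.

Section Measurements.
Variables (R : realType) (d : nat).
Local Notation C := R[i].

(* The order of C is partial: 0 <= z says that z is real and nonnegative. *)
Definition psdmx (A : 'M[C]_d) : Prop :=
  A \is hermsymmx /\ forall x : 'cV[C]_d, 0 <= (x ^t* *m A *m x) 0 0.

Definition orthoprojmx (P : 'M[C]_d) : Prop :=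
  P \is hermsymmx /\ P *m P = P.

Definition povm (n : nat) (E : 'I_n -> 'M[C]_d) : Prop :=
  (forall a, psdmx (E a)) /\ \sum_a E a = 1%:M.

Definition projective_measurement (n : nat) (P : 'I_n -> 'M[C]_d) : Prop :=
  povm P /\ forall a, orthoprojmx (P a).

Definition projectively_simulable (n : nat) (E : 'I_n -> 'M[C]_d) : Prop :=
  exists (N : nat) (q : 'I_N -> R) (P : 'I_N -> 'I_n -> 'M[C]_d),
    [/\ forall l, 0 <= q l,
        \sum_l q l = 1,
        forall l, projective_measurement (P l)
      & forall a, E a = \sum_l (q l)%:C *: P l a].

Definition depolarise (v : R) (X : 'M[C]_d) : 'M[C]_d :=
  v%:C *: X + ((1 - v)%:C / d%:R * \tr X)%:M.

Definition simulable_visibilities (n : nat) (E : 'I_n -> 'M[C]_d) : set R :=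
  [set v | 0 <= v <= 1 /\ projectively_simulable (fun a => depolarise v (E a))].

(* v is the maximum (not merely the supremum) of the simulable visibilities. *)
Definition is_projsim_threshold (n : nat) (E : 'I_n -> 'M[C]_d) (v : R) : Prop :=
  simulable_visibilities E v /\ ubound (simulable_visibilities E) v.

End Measurements.

Section Hesse.
Variable R : realType.
Local Notation C := R[i].

(* exp (2 i pi / 3), by Euler's formula *)
Definition omega : C := cos (2 * pi / 3) +i* sin (2 * pi / 3).

Local Notation w := omega.

Definition hesse_mx : 'M[C]_(3, 9) :=
  \matrix_(i, j) nth 0 (nth [::]
    [:: [::  0;  0;       0;   -1; - w ^+ 2; - w;        1;  w;       w ^+ 2];
        [::  1;  w;       w ^+ 2;  0;  0;       0;  -1; - w ^+ 2; - w];
        [:: -1; - w ^+ 2; - w;   1;  w;       w ^+ 2;   0;  0;       0]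
    ] i) j.

Definition hesse_vec (a : 'I_9) : 'cV[C]_3 :=
  (Num.sqrt 2)^-1%:C *: col a hesse_mx.

Definition hesse (a : 'I_9) : 'M[C]_3 :=
  3^-1 *: (hesse_vec a *m (hesse_vec a) ^t*).

End Hesse.

(* Main.v *)
(** Let h_a be the columns of the Hesse matrix, of squared norm 2 and with mutual inner
    products of modulus 1. The triple product <h_a|h_b><h_b|h_c><h_c|h_a> of three distinct
    columns is -1 (the vectors are linearly dependent), - omega^2 or - omega (the same triple
    with two vectors exchanged). In the second case, symmetric orthogonalisation turns the
    three vectors into an orthonormal basis, hence into a projective measurement supported on
    the outcomes a, b, c.

    Upper bound: a projective measurement P of C^3 has at most three nonzero elements, because
    their ranks add up to 3, so sum_a <h_a|P_a h_a> involves one triple only. Semidefinite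
    duality bounds it by tr K for any K above the three operators |h_a><h_a|. The bound
    8 (1 + cos (pi / 9)) / 3 obtained is attained by the measurements above, and comparing it
    with the value 2 + 4 v of the functional on the depolarised Hesse POVM bounds v.

    Lower bound: the uniform mixture of these measurements over all positively oriented
    triples is the depolarised Hesse POVM. This reduces to finite sums in Z[omega], evaluated
    by computation. *)

Require Import Defs.
From mathcomp Require Import all_boot all_order all_algebra.
From mathcomp Require Import sesquilinear spectral.
From mathcomp Require Import all_classical all_reals all_analysis.
From mathcomp Require Import complex ring lra.
Import Order.TTheory GRing.Theory Num.Theory.
Local Open Scope ring_scope.

Set Implicit Arguments.
Unset Strict Implicit.
Unset Printing Implicit Defensive.

(** * Linear algebra *)

Lemma big_ord3 (V : nmodType) (f : 'I_3 -> V) : \sum_i f i = f 0 + f 1 + f 2.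
Proof.
rewrite !big_ord_recl big_ord0 addr0 addrA.
by congr (_ + f _ + f _); apply: val_inj.
Qed.

Section LinearAlgebra.
Local Open Scope sesquilinear_scope.
Variables (F : numClosedFieldType) (d : nat).
Implicit Types (u v x : 'cV[F]_d) (P X : 'M[F]_d).

Definition ip u v : F := (u ^t* *m v) 0 0.
Definition outer u v : 'M[F]_d := u *m v ^t*.

Lemma ipE u v : ip u v = \sum_i (u i 0)^* * v i 0.
Proof. by rewrite /ip mxE; apply: eq_bigr => i _; rewrite !mxE. Qed.

Lemma outerE u v i j : outer u v i j = u i 0 * (v j 0)^*.
Proof. by rewrite mxE big_ord1 !mxE. Qed.

Lemma ipC u v : (ip u v)^* = ip v u.
Proof.
rewrite !ipE rmorph_sum; apply: eq_bigr => i _.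
by rewrite rmorphM /= conjCK mulrC.
Qed.

Lemma ipDr u v x : ip u (v + x) = ip u v + ip u x.
Proof. by rewrite /ip mulmxDr mxE. Qed.

Lemma ipZr u c v : ip u (c *: v) = c * ip u v.
Proof. by rewrite /ip -scalemxAr mxE. Qed.

Lemma ipBr u v x : ip u (v - x) = ip u v - ip u x.
Proof. by rewrite -scaleN1r ipDr ipZr mulN1r. Qed.

Lemma ipDl u v x : ip (u + v) x = ip u x + ip v x.
Proof. by rewrite -ipC ipDr rmorphD /= !ipC. Qed.

Lemma ipZl u c v : ip (c *: u) v = c^* * ip u v.
Proof. by rewrite -ipC ipZr rmorphM /= ipC. Qed.

Lemma ip_eq0 u : ip u u = 0 -> u = 0.
Proof.
rewrite ipE => /eqP; rewrite psumr_eq0; last first.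
  by move=> i _; rewrite mulrC mul_conjC_ge0.
move=> /allP u0; apply/matrixP => i j; rewrite ord1 mxE.
have := u0 i (mem_index_enum i).
by rewrite mulrC mul_conjC_eq0 => /eqP.
Qed.

Lemma ip_mulmx_outer x u v : ip x (outer u v *m x) = ip x u * ip v x.
Proof.
by rewrite /ip mulmxA mulmxA -mulmxA mxE big_ord1.
Qed.

Lemma mxtrace_outer u v : \tr (outer u v) = ip v u.
Proof.
by rewrite /mxtrace ipE; apply: eq_bigr => i _; rewrite outerE mulrC.
Qed.

Lemma mxtrace_mul_outer X u v : \tr (X *m outer u v) = ip v (X *m u).
Proof. by rewrite mulmxA mxtrace_outer. Qed.

Lemma outerZ c u : outer (c *: u) (c *: u) = (c * c^*) *: outer u u.
Proof.
by apply/matrixP => i j; rewrite [RHS]mxE !outerE !mxE rmorphM /= mulrACA.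
Qed.

Lemma hermsymmxP X : X ^t* = X <-> X \is hermsymmx.
Proof.
split=> [XE|/is_hermitianmxP]; last by rewrite expr0 scale1r.
by apply/is_hermitianmxP; rewrite expr0 scale1r.
Qed.

(* tr (P X) = tr (P X P) is a sum of values of the form X, at the columns of P. *)
Lemma mxtrace_proj_ge0 P X : P ^t* = P -> P *m P = P ->
  (forall x, 0 <= ip x (X *m x)) -> 0 <= \tr (P *m X).
Proof.
move=> Pherm Pid Xpos.
have -> : \tr (P *m X) = \tr (P *m X *m P).
  by rewrite (mxtrace_mulC (P *m X)) mulmxA Pid.
apply: sumr_ge0 => i _.
have -> : (P *m X *m P) i i = ip (col i P) (X *m col i P).
  rewrite -{1}Pherm -mulmxA mxE ipE; apply: eq_bigr => k _.
  rewrite !mxE; congr (_ * _).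
  by apply: eq_bigr => l _; rewrite mxE.
exact: Xpos.
Qed.

(** Weak semidefinite duality: since the [P i] add up to the identity, the gap is the sum of tr (P_i
    (K - |x_i><x_i|)), and each term is nonnegative. *)
Lemma dual_bound n (K : 'M[F]_d) (x : 'I_n -> 'cV[F]_d) (P : 'I_n -> 'M[F]_d) :
  (forall i z, 0 <= ip z ((K - outer (x i) (x i)) *m z)) ->
  (forall i, P i ^t* = P i) -> (forall i, P i *m P i = P i) ->
  \sum_i P i = 1%:M ->
  \sum_i ip (x i) (P i *m x i) <= \tr K.
Proof.
move=> Kge Pherm Pid P1; rewrite -[K in \tr K]mul1mx -P1.
rewrite mulmx_suml raddf_sum -subr_ge0 -sumrB /=; apply: sumr_ge0 => i _.
rewrite -mxtrace_mul_outer -raddfB /= -mulmxBr.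
exact: mxtrace_proj_ge0 (Kge i).
Qed.

(** Cancelling the full-rank factors of [P] on both sides of P P = P leaves an identity matrix whose
    size is the rank; the trace is cyclic. *)
Lemma mxtrace_idmx_rank P : P *m P = P -> \tr P = (\rank P)%:R.
Proof.
move=> Pid; have RC : row_base P *m col_base P = 1%:M.
  apply: (row_free_inj (row_base_free P)).
  have : col_base P *m (row_base P *m col_base P *m row_base P)
         = col_base P *m row_base P.
    by rewrite -mulmxA mulmxA mulmx_base Pid.
  rewrite mul1mx => E.
  apply/trmx_inj; apply: (@row_free_inj _ _ _ _ (col_base P)^T).
    by rewrite /row_free mxrank_tr; apply: (col_base_full P).
  by rewrite -!trmx_mul E.
by rewrite -[in LHS](mulmx_base P) mxtrace_mulC RC mxtrace1.
Qed.

(** A left inverse of a square matrix is also a right inverse, so orthonormal columns are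
    complete. *)
Lemma orthonormal_outer_sum (y : 'I_d -> 'cV[F]_d) :
  (forall i j, ip (y i) (y j) = (i == j)%:R) ->
  \sum_i outer (y i) (y i) = 1%:M.
Proof.
move=> yON; pose W := \matrix_(i, j) y j i 0 : 'M[F]_d.
have /mulmx1C <- : W ^t* *m W = 1%:M.
  apply/matrixP => i j; rewrite !mxE -yON ipE.
  by apply: eq_bigr => k _; rewrite !mxE.
apply/matrixP => i j; rewrite summxE mxE; apply: eq_bigr => k _.
by rewrite outerE !mxE.
Qed.

Lemma parseval (y : 'I_d -> 'cV[F]_d) u v :
  (forall i j, ip (y i) (y j) = (i == j)%:R) ->
  ip u v = \sum_i ip u (y i) * ip (y i) v.
Proof.
move=> /orthonormal_outer_sum y1.
rewrite -[v in LHS]mul1mx -y1 mulmx_suml /ip mulmx_sumr summxE.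
by apply: eq_bigr => i _; rewrite !mulmxA -mulmxA mxE big_ord1.
Qed.

End LinearAlgebra.

(** * Triples of equiangular vectors *)

Section HermitianForm.
Variables (F : numClosedFieldType).

(** Let M be the Hermitian matrix with diagonal [n] and upper entries [a], [b], [c]. The form n M
    dominates the rank-one form of the first row of M: [X] cancels from the difference, and an
    explicit sum of squares in [Y], [Z] remains. *)
Lemma diagonal_dominance (n a b c X Y Z : F) : n^* = n ->
  4 * (a * a^*) <= n ^+ 2 -> 4 * (b * b^*) <= n ^+ 2 -> 4 * (c * c^*) <= n ^+ 2 ->
  0 <= n * (X^* * (n * X + a * Y + b * Z) + Y^* * (a^* * X + n * Y + c * Z)
            + Z^* * (b^* * X + c^* * Y + n * Z))
       - (n * X + a * Y + b * Z)^* * (n * X + a * Y + b * Z).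
Proof.
move=> nR Ha Hb Hc.
have -> : n * (X^* * (n * X + a * Y + b * Z) + Y^* * (a^* * X + n * Y + c * Z)
            + Z^* * (b^* * X + c^* * Y + n * Z))
       - (n * X + a * Y + b * Z)^* * (n * X + a * Y + b * Z)
  = (a * Y - b * Z) * (a * Y - b * Z)^*
    + 2^-1 * ((n * Y + 2 * c * Z) * (n * Y + 2 * c * Z)^*)
    + 2^-1 * ((n ^+ 2 - 4 * (a * a^*)) * (Y * Y^*))
    + 2^-1 * ((n ^+ 2 - 4 * (b * b^*)) * (Z * Z^*))
    + 2^-1 * ((n ^+ 2 - 4 * (c * c^*)) * (Z * Z^*)).
  rewrite !(rmorphD, rmorphB, rmorphN, rmorphM) /= nR ?conjC_nat ?conjCK.
  by field.
have half_ge0 : 0 <= 2^-1 :> F by rewrite invr_ge0 ler0n.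
by repeat apply: addr_ge0; rewrite ?mul_conjC_ge0 // mulr_ge0 ?mul_conjC_ge0 //
  mulr_ge0 ?subr_ge0 ?mul_conjC_ge0.
Qed.

End HermitianForm.

(** * Symmetric orthogonalisation of a triple and its dual certificate *)

Section EquiangularTriple.
Local Open Scope sesquilinear_scope.
Variables (F : numClosedFieldType) (p q t : F).
Hypotheses (pR : p^* = p) (t1 : t * t^* = 1).
Hypothesis unit_norm :
  2 * p ^+ 2 + 4 * (q * q^*) + 2 * p * (q + q^*)
  + (q^* ^+ 2 * t + q ^+ 2 * t^*) = 1.
Hypothesis orthogonality :
  p ^+ 2 + 4 * (p * q^*) + 2 * (q * q^*) + q^* ^+ 2
  + 2 * (p * q * t^*) + 2 * (q ^+ 2 * t^*) = 0.

(** With y the basis below, [n0] is <x_i|y_i> and [n1] is <x_0|y_1>; all <x_i|y_j> with distinct i,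
    j have the modulus of [n1]. *)
Let n0 : F := 2 * p + q + q^*.
Let n1 : F := p + q * t^* + 2 * q^*.
Hypothesis dominance : 4 * (n1 * n1^*) <= n0 ^+ 2.

Variables (x0 x1 x2 : 'cV[F]_3).
Hypotheses (x00 : ip x0 x0 = 2) (x11 : ip x1 x1 = 2) (x22 : ip x2 x2 = 2).
Hypotheses (x01 : ip x0 x1 = 1) (x02 : ip x0 x2 = 1) (x12 : ip x1 x2 = t).

Definition comb3 (a b c : F) (u v w : 'cV[F]_3) := a *: u + b *: v + c *: w.

Lemma ip_comb3r a b c (u v w x : 'cV[F]_3) :
  ip x (comb3 a b c u v w) = a * ip x u + b * ip x v + c * ip x w.
Proof. by rewrite !ipDr !ipZr. Qed.

Lemma ip_comb3l a b c (u v w x : 'cV[F]_3) :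
  ip (comb3 a b c u v w) x = a^* * ip u x + b^* * ip v x + c^* * ip w x.
Proof. by rewrite !ipDl !ipZl. Qed.

(** The coefficients form a Hermitian matrix S, and orthonormality says S G S = 1 for the Gram
    matrix G. The phases [t] make the construction covariant under cyclic rotation. *)
Definition triple_basis (i : 'I_3) : 'cV[F]_3 :=
  nth 0 [:: comb3 p q q^* x0 x1 x2; comb3 q^* p (q * t^*) x0 x1 x2;
            comb3 q (q^* * t) p x0 x1 x2] i.

Let x10 : ip x1 x0 = 1. Proof. by rewrite -ipC x01 rmorph1. Qed.
Let x20 : ip x2 x0 = 1. Proof. by rewrite -ipC x02 rmorph1. Qed.
Let x21 : ip x2 x1 = t^*. Proof. by rewrite -ipC x12. Qed.

Let gram := (x00, x11, x22, x01, x02, x12, x10, x20, x21).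

Let t_neq0 : t != 0.
Proof.
by apply: contra_eq_neq t1 => ->; rewrite mul0r eq_sym oner_eq0.
Qed.

Let tV : t^* = t^-1.
Proof. by apply: (mulfI t_neq0); rewrite t1 mulfV. Qed.

Let orthogonality' :
  p ^+ 2 + 4 * (p * q) + 2 * (q * q^*) + q ^+ 2
  + 2 * (p * q^* * t) + 2 * (q^* ^+ 2 * t) = 0.
Proof.
have := congr1 Num.conj orthogonality; rewrite rmorph0 => <-.
rewrite !(rmorphD, rmorphM, rmorphXn) /= !conjCK pR ?conjC_nat.
by ring.
Qed.

(** <y_0|y_2> is the conjugate of <y_0|y_1>, and <y_1|y_2> is [t] times <y_0|y_1>, so one
    off-diagonal equation is enough. *)
Lemma triple_basis_orthonormal i j :
  ip (triple_basis i) (triple_basis j) = (i == j)%:R.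
Proof.
have y01 : ip (triple_basis 0) (triple_basis 1) = 0.
  rewrite /triple_basis /= ip_comb3l !ip_comb3r !gram !conjCK pR -orthogonality.
  by rewrite tV; field.
have y02 : ip (triple_basis 0) (triple_basis 2) = 0.
  rewrite /triple_basis /= ip_comb3l !ip_comb3r !gram !conjCK pR -orthogonality'.
  by rewrite tV; field.
have y12 : ip (triple_basis 1) (triple_basis 2) = 0.
  rewrite /triple_basis /= ip_comb3l !ip_comb3r !gram !rmorphM /= !conjCK pR.
  rewrite -[RHS](mulr0 t) -orthogonality tV.
  by field.
have unit k : ip (triple_basis k) (triple_basis k) = 1.
  rewrite -unit_norm; case: k => [[|[|[|//]]] k3] /=;
  rewrite /triple_basis /= ip_comb3l !ip_comb3r !gram ?rmorphM /= ?conjCK pR tV;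
  by field.
have [->|] := eqVneq i j; first exact: unit.
case: i j => [[|[|[|//]]] i3] [[|[|[|//]]] j3] //= _;
  by [exact: y01 | exact: y02 | exact: y12
     | rewrite -ipC [X in X^*]y01 rmorph0 | rewrite -ipC [X in X^*]y02 rmorph0
     | rewrite -ipC [X in X^*]y12 rmorph0].
Qed.

Let n0R : n0^* = n0.
Proof. by rewrite /n0 !rmorphD rmorphM /= conjC_nat conjCK pR addrAC. Qed.

Let xy (i j : 'I_3) : F :=
  nth 0 (nth [::] [:: [:: n0; n1; n1^*]; [:: n1^*; n0; t * n1];
                      [:: n1; (t * n1)^*; n0]] i) j.

Let x (i : 'I_3) : 'cV[F]_3 := nth 0 [:: x0; x1; x2] i.

Let ip_xy i j : ip (x i) (triple_basis j) = xy i j.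
Proof.
case: i j => [[|[|[|//]]] i3] [[|[|[|//]]] j3]; rewrite /x /xy /triple_basis /=;
  rewrite ip_comb3r !gram /n0 /n1 ?(rmorphD, rmorphM) /= ?conjCK ?pR ?conjC_nat ?tV;
  by field.
Qed.

(* The optimal dual operator n0 * sum_k |y_k><x_k| dominates every |x_k><x_k|. *)
Definition triple_dual : 'M[F]_3 :=
  n0 *: \sum_i outer (triple_basis i) (x i).

Lemma mxtrace_triple_dual : \tr triple_dual = 3 * n0 ^+ 2.
Proof.
rewrite mxtraceZ big_ord3 !mxtraceD !mxtrace_outer !ip_xy /xy /=.
by ring.
Qed.

(** In the coordinates [Z] along the basis, the dual operator is [n0] times the Hermitian overlap
    matrix [xy], and [x i] is given by a row of [xy]: this is the setting of
    [diagonal_dominance]. *)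
Lemma triple_dual_ge i z : 0 <= ip z ((triple_dual - outer (x i) (x i)) *m z).
Proof.
rewrite mulmxBl ipBr ip_mulmx_outer -[ip z (x i)]ipC.
pose Z k := ip (triple_basis k) z.
have ipx k : ip (x k) z = xy k 0 * Z 0 + xy k 1 * Z 1 + xy k 2 * Z 2.
  by rewrite (parseval _ _ triple_basis_orthonormal) big_ord3 !ip_xy.
have -> : ip z (triple_dual *m z) = n0 * ((Z 0)^* * ip (x 0) z +
    (Z 1)^* * ip (x 1) z + (Z 2)^* * ip (x 2) z).
  rewrite -scalemxAl ipZr mulmx_suml big_ord3 !ipDr !ip_mulmx_outer.
  by rewrite /Z !ipC.
have N k : 4 * (k * k^*) <= n0 ^+ 2 -> 4 * (k^* * k^*^*) <= n0 ^+ 2.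
  by rewrite conjCK [k^* * k]mulrC.
have tN : 4 * (t * n1 * (t * n1)^*) <= n0 ^+ 2.
  by rewrite rmorphM mulrACA t1 mul1r.
(* [n0] and [n1] become atoms. Each case puts coordinate [i] first, which conjugates some
   off-diagonal entries. *)
rewrite !ipx /xy; clear ipx; move: n0 n1 n0R dominance N tN => m0 m1 m0R dom N tN.
case: i => [[|[|[|//]]] i3] /=.
- have := diagonal_dominance (Z 0) (Z 1) (Z 2) m0R dom (N _ dom) tN.
  by congr (0 <= _); rewrite !(rmorphD, rmorphM) /= !conjCK; ring.
- have := diagonal_dominance (Z 1) (Z 0) (Z 2) m0R (N _ dom) tN (N _ dom).
  by congr (0 <= _); rewrite !(rmorphD, rmorphM) /= !conjCK; ring.
- have := diagonal_dominance (Z 2) (Z 0) (Z 1) m0R dom (N _ tN) dom.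
  by congr (0 <= _); rewrite !(rmorphD, rmorphM) /= !conjCK; ring.
Qed.

Lemma triple_bound (P : 'I_3 -> 'M[F]_3) :
  (forall i, P i ^t* = P i) -> (forall i, P i *m P i = P i) ->
  \sum_i P i = 1%:M ->
  \sum_(i < 3) ip (nth 0 [:: x0; x1; x2] i) (P i *m nth 0 [:: x0; x1; x2] i) <= 3 * n0 ^+ 2.
Proof.
by move=> Ph Pi P1; rewrite -mxtrace_triple_dual; apply: dual_bound triple_dual_ge Ph Pi P1.
Qed.

End EquiangularTriple.

(* Rotating a triple changes its basis vectors by phases only. *)
Section Rotation.
Variables (F : numClosedFieldType) (p q u v w : F) (x0 x1 x2 : 'cV[F]_3).
Hypotheses (u1 : u * u^* = 1) (v1 : v * v^* = 1) (w1 : w * w^* = 1).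
(** For Hesse vectors, [u], [v], [w] will be <h_a|h_b>, <h_b|h_c>, <h_c|h_a>, so that [t] is their
    triple product. *)
Let t := u * v * w.
Let basis := triple_basis p q t x0 (u^* *: x1) (w *: x2).

Let outer_phase k (y z : 'cV[F]_3) : k * k^* = 1 -> z = k *: y -> outer y y = outer z z.
Proof. by move=> k1 ->; rewrite outerZ k1 scale1r. Qed.

Lemma triple_basis_rot1 :
  let y := comb3 p q q^* x1 (v^* *: x2) (u *: x0) in
  outer (basis 1) (basis 1) = outer y y.
Proof.
apply: (outer_phase u1).
rewrite /basis /triple_basis /= /comb3 !scalerDr !scalerA /t !rmorphM /=.
rewrite -[RHS]addrA [RHS]addrC; congr (_ *: _ + _ *: _ + _ *: _).
- by rewrite mulrAC u1 mul1r.
- transitivity (q * v^* * (u * u^*) * (w * w^*)); last by ring.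
  by rewrite u1 w1 !mulr1.
- by rewrite mulrC.
Qed.

Lemma triple_basis_rot2 :
  let y := comb3 p q q^* x2 (w^* *: x0) (v *: x1) in
  outer (basis 2) (basis 2) = outer y y.
Proof.
apply: (outer_phase (k := w^*)); first by rewrite conjCK mulrC.
rewrite /basis /triple_basis /= /comb3 !scalerDr !scalerA /t [RHS]addrC addrA.
congr (_ *: _ + _ *: _ + _ *: _).
- by rewrite mulrAC [w^* * w]mulrC w1 mul1r.
- by rewrite mulrC.
- transitivity (q^* * v * (u * u^*) * (w * w^*)); last by ring.
  by rewrite u1 w1 !mulr1.
Qed.

End Rotation.

(** * Linearly dependent triples *)

Section LinearlyDependentTriple.
Local Open Scope sesquilinear_scope.
Variables (F : numClosedFieldType) (x0 x1 x2 : 'cV[F]_3).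
Hypotheses (x00 : ip x0 x0 = 2) (x11 : ip x1 x1 = 2) (x22 : ip x2 x2 = 2).
Hypotheses (x01 : ip x0 x1 = 1) (x02 : ip x0 x2 = 1) (x12 : ip x1 x2 = -1).

(** The squared norm of x0 - x1 - x2 is 6 - 2 - 2 - 2 = 0. *)
Lemma dependent_relation : x0 = x1 + x2.
Proof.
apply/eqP; rewrite -subr_eq0; apply/eqP/ip_eq0.
have x10 : ip x1 x0 = 1 by rewrite -ipC x01 rmorph1.
have x20 : ip x2 x0 = 1 by rewrite -ipC x02 rmorph1.
have x21 : ip x2 x1 = -1 by rewrite -ipC x12 rmorphN1.
rewrite -scaleN1r !(ipDl, ipDr, ipZl, ipZr) x00 x01 x02 x10 x20 x21 x11 x22 x12.
by rewrite rmorphN1; ring.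
Qed.

Lemma dependent_bound (P : 'I_3 -> 'M[F]_3) :
  (forall i, P i ^t* = P i) -> (forall i, P i *m P i = P i) ->
  \sum_i P i = 1%:M ->
  \sum_(i < 3) ip (nth 0 [:: x0; x1; x2] i) (P i *m nth 0 [:: x0; x1; x2] i) <= 4.
Proof.
pose x (i : 'I_3) : 'cV[F]_3 := nth 0 [:: x0; x1; x2] i.
(* Up to the sign of [x0] the vectors form a trine in a plane, so [K] is twice the projection onto
   that plane. *)
pose K := (2 / 3) *: \sum_i outer (x i) (x i).
have <- : \tr K = 4.
  rewrite mxtraceZ big_ord3 !mxtraceD !mxtrace_outer /x /= x00 x11 x22.
  by field.
apply: (dual_bound (x := x)) => i z.
rewrite mulmxBl ipBr -scalemxAl ipZr mulmx_suml big_ord3 !ipDr !ip_mulmx_outer.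
have third_ge0 : 0 <= 3^-1 :> F by rewrite invr_ge0 ler0n.
rewrite -![ip z _]ipC /x.
have x0z : ip x0 z = ip x1 z + ip x2 z by rewrite dependent_relation ipDl.
case: i => [[|[|[|//]]] i3] /=; rewrite x0z; set u := ip x1 z; set v := ip x2 z.
- have := mulr_ge0 third_ge0 (mul_conjC_ge0 (u - v)).
  by congr (0 <= _); rewrite !(rmorphD, rmorphN) /=; field.
- have := mulr_ge0 third_ge0 (mul_conjC_ge0 (u + v + v)).
  by congr (0 <= _); rewrite !(rmorphD, rmorphN) /=; field.
- have := mulr_ge0 third_ge0 (mul_conjC_ge0 (u + v + u)).
  by congr (0 <= _); rewrite !(rmorphD, rmorphN) /=; field.
Qed.

End LinearlyDependentTriple.

(** * Projective measurements, mixtures and ranks *)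

Section Measurements.
Local Open Scope sesquilinear_scope.
Local Open Scope complex_scope.
Variables (R : realType) (d : nat).
Implicit Types y : 'I_d -> 'cV[R[i]]_d.

(** Allows mixtures indexed by triples of outcomes. *)
Lemma simulable_finType (J : finType) n (E : 'I_n -> 'M[R[i]]_d)
    (q : J -> R) (P : J -> 'I_n -> 'M[R[i]]_d) :
  (forall j, 0 <= q j) -> \sum_j q j = 1 ->
  (forall j, projective_measurement (P j)) ->
  (forall a, E a = \sum_j (q j)%:C *: P j a) ->
  projectively_simulable E.
Proof.
move=> q0 q1 PM EE; exists #|J|, (q \o enum_val), (P \o enum_val); split=> /=.
- by move=> l.
- by rewrite -q1 [RHS](eq_bigl (mem J)) // [RHS]big_enum_val.
- by move=> l.
by move=> a; rewrite EE [LHS](eq_bigl (mem J)) // [LHS]big_enum_val.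
Qed.

Definition basis_measurement n y (f : 'I_d -> 'I_n) (a : 'I_n) : 'M[R[i]]_d :=
  \sum_(i | f i == a) outer (y i) (y i).

Lemma basis_measurementP n y (f : 'I_d -> 'I_n) :
  (forall i j, ip (y i) (y j) = (i == j)%:R) ->
  projective_measurement (basis_measurement y f).
Proof.
move=> yON; have herm a : basis_measurement y f a \is hermsymmx.
  apply/hermsymmxP; rewrite /basis_measurement.
  apply/matrixP => i j; rewrite !mxE !summxE rmorph_sum.
  by apply: eq_bigr => k _; rewrite !outerE rmorphM /= conjCK mulrC.
split; last first.
  move=> a; split=> //; rewrite /basis_measurement mulmx_suml.
  apply: eq_bigr => i fi; rewrite mulmx_sumr (bigD1 i) //= big1 => [|j /andP[_ ji]].
    rewrite addr0 /outer mulmxA -(mulmxA (y i)).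
    have -> : (y i)^t* *m y i = 1%:M.
      by apply/matrixP => k l; rewrite !ord1 -/(ip _ _) yON eqxx mxE.
    by rewrite mulmx1.
  rewrite /outer mulmxA -(mulmxA (y i)).
  have -> : (y i)^t* *m y j = 0.
    by apply/matrixP => k l; rewrite !ord1 -/(ip _ _) yON eq_sym (negPf ji) mxE.
  by rewrite mulmx0 mul0mx.
split=> [a|]; last first.
  rewrite -(orthonormal_outer_sum yON).
  by rewrite (partition_big f xpredT).
split=> // x; rewrite -mulmxA -/(ip _ _) mulmx_suml /ip mulmx_sumr summxE.
apply: sumr_ge0 => i _.
by rewrite -/(ip _ _) ip_mulmx_outer -ipC mulrC mul_conjC_ge0.
Qed.

Lemma sum_rank_projective n (P : 'I_n -> 'M[R[i]]_d) :
  projective_measurement P -> (\sum_a \rank (P a))%N = d.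
Proof.
move=> [[_ P1] Pproj]; have := congr1 mxtrace P1.
rewrite mxtrace1 raddf_sum (eq_bigr (fun a => (\rank (P a))%:R)) => [|a _].
  by rewrite -natr_sum => /eqP; rewrite eqr_nat => /eqP.
by apply: mxtrace_idmx_rank; have [] := Pproj a.
Qed.

Lemma card_outcomes_projective n (P : 'I_n -> 'M[R[i]]_d) :
  projective_measurement P -> (#|[set a | P a != 0%R]| <= d)%N.
Proof.
move=> /sum_rank_projective sumP; rewrite -[leqRHS]sumP -sum1dep_card big_mkcond /=.
apply: leq_sum => a _; case: ifP => // Pa.
by rewrite lt0n mxrank_eq0.
Qed.

End Measurements.

(** Fewer than [k] outcomes may be nonzero, so they are padded to exactly [k]: list [S] first, then
    its complement, and keep the first [k] entries. *)
Lemma cover_by_injection n k (S : {set 'I_n}) : (#|S| <= k <= n)%N ->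
  exists2 f : 'I_k -> 'I_n, injective f & forall x, x \in S -> x \in codom f.
Proof.
case/andP=> Sk kn; pose s := enum S ++ enum (~: S).
have sz : size s = n by rewrite size_cat -!cardE cardsC card_ord.
have us : uniq s.
  rewrite cat_uniq !enum_uniq andbT /=; apply/hasPn => x.
  by rewrite !mem_enum inE.
(* For positive [k] the bound [kn] provides the default element that [nth] requires. *)
case: k kn Sk => [|k] kn Sk.
  exists (fun i => widen_ord kn i) => [i|x xS]; first by case: i.
  by move: Sk; rewrite leqn0 cards_eq0 => /eqP S0; rewrite S0 inE in xS.
have x0 : 'I_n := Ordinal kn.
exists (fun i : 'I_k.+1 => nth x0 s i) => [i j /eqP|x xS].
  by rewrite nth_uniq ?sz ?(leq_trans _ kn) // => /eqP/val_inj.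
have xk : (index x s < k.+1)%N.
  rewrite index_cat mem_enum xS (leq_trans _ Sk) // cardE index_mem.
  by rewrite mem_enum.
apply/codomP; exists (Ordinal xk); rewrite /= nth_index //.
by rewrite mem_cat mem_enum xS.
Qed.

Lemma sum_codom (V : nmodType) n k (f : 'I_k -> 'I_n) (g : 'I_n -> V) :
  injective f -> (forall x, x \notin codom f -> g x = 0) ->
  \sum_x g x = \sum_i g (f i).
Proof.
move=> injf g0; rewrite (bigID (fun x => x \in codom f)) /= [X in _ + X]big1 // addr0.
transitivity (\sum_(x in f @: 'I_k) g x).
  by apply: eq_bigl => x; apply/codomP/imsetP => [[i ->]|[i _ ->]]; exists i.
by rewrite big_imset //= => i j _ _; apply: injf.
Qed.

(** * Trigonometric weights *)

Section Trigonometry.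
Variable R : realType.
Implicit Types x : R.

Lemma cos_triple x : cos (3 * x) = 4 * cos x ^+ 3 - 3 * cos x.
Proof.
have -> : 3 * x = x + x + x by ring.
transitivity (cos x ^+ 3 - 3 * cos x * sin x ^+ 2).
  by rewrite !(cosD, sinD); ring.
by rewrite sin2cos2; ring.
Qed.

Lemma cos_pi_div_gt0 (n : nat) : (2 < n)%N -> 0 < cos (pi / n%:R : R).
Proof.
move=> n2; apply: cos_gt0_pihalf.
have n0 : 0 < n%:R :> R by rewrite ltr0n; case: n n2.
apply/andP; split.
  by rewrite (@lt_trans _ _ 0) ?oppr_lt0 ?divr_gt0 ?pi_gt0.
by rewrite ltr_pM2l ?pi_gt0 // ltf_pV2 ?posrE // ltr_nat.
Qed.

Lemma cos_pi_third : cos (pi / 3 : R) = 1 / 2.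
Proof.
have := cos_triple (pi / 3); rewrite mulrC divfK ?pnatr_eq0 // cospi => E.
have := @cos_pi_div_gt0 3 isT; set c := cos _ in E * => c0.
(* This is the factorisation of 4 c^3 - 3 c + 1; positivity excludes c = -1. *)
have : (c + 1) * (2 * c - 1) ^+ 2 = 0 by lra.
by move/eqP; rewrite mulf_eq0 sqrf_eq0 => /orP[] /eqP; lra.
Qed.

Lemma sin_pi_third_sqr : sin (pi / 3 : R) ^+ 2 = 3 / 4.
Proof. by have := cos2Dsin2 (pi / 3 : R); rewrite cos_pi_third; lra. Qed.

Lemma cos_pi_ninth : 8 * cos (pi / 9 : R) ^+ 3 = 6 * cos (pi / 9 : R) + 1.
Proof.
have := cos_triple (pi / 9 : R).
have -> : 3 * (pi / 9) = pi / 3 :> R by field.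
by rewrite cos_pi_third; lra.
Qed.

(** If 0 < c < 1/2, then c^3 <= c / 4, which contradicts 8 c^3 = 6 c + 1. *)
Lemma cos_pi_ninth_ge_half : 1 / 2 <= cos (pi / 9 : R).
Proof.
have := cos_pi_ninth; have := @cos_pi_div_gt0 9 isT; set c := cos _ => c0 E.
rewrite leNgt; apply/negP => c2.
have : c ^+ 3 <= c by rewrite exprS ger_pMr // expr_le1 ?ltW //; lra.
suff : c ^+ 3 <= c * (1 / 4) by lra.
by rewrite exprS ler_wpM2l ?ltW //; nra.
Qed.

End Trigonometry.

Section Weights.
Local Open Scope complex_scope.
Variable R : realType.
Let C : R := cos (pi / 9).
Let s : R := sin (pi / 3).

Lemma conjCE (a b : R) : (a +i* b)^*%R = a -i* b.
Proof. by []. Qed.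

Lemma real_conjC (a : R) : (a%:C)^*%R = a%:C.
Proof. by rewrite /real_complex_def conjCE oppr0. Qed.

(* The first column (p, q, q^* ) of the inverse square root of the Gram matrix of a triple
   of Hesse vectors whose triple product is [tau]. *)
Definition wp : R[i] := (2 * s * (1 + 4 * C) / 9)%:C.
Definition wq : R[i] :=
  (2 * s * (4 * C ^+ 2 - 2 * C - 3) / 9) +i* (2 / 3 * (1 + C - 2 * C ^+ 2)).
Definition tau : R[i] := (1 / 2) +i* s.

Lemma wpR : wp^*%R = wp. Proof. exact: real_conjC. Qed.

(* [lra] treats monomials as atoms, so it proves an equation in Q(C, s) from these rules. *)
Lemma monomial_reduction :
  (C ^+ 3 = (6 * C + 1) / 8 /\ C ^+ 4 = (6 * C ^+ 2 + C) / 8 /\ s ^+ 2 = 3 / 4) /\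
  (s ^+ 2 * C = 3 / 4 * C /\ s ^+ 2 * C ^+ 2 = 3 / 4 * C ^+ 2 /\
   s ^+ 2 * C ^+ 3 = 3 / 4 * C ^+ 3 /\ s ^+ 2 * C ^+ 4 = 3 / 4 * C ^+ 4) /\
  (s ^+ 3 = 3 / 4 * s /\ s ^+ 3 * C = 3 / 4 * (s * C) /\
   s ^+ 3 * C ^+ 2 = 3 / 4 * (s * C ^+ 2) /\
   s ^+ 3 * C ^+ 3 = 3 / 4 * (s * C ^+ 3) /\
   s ^+ 3 * C ^+ 4 = 3 / 4 * (s * C ^+ 4)) /\
  (s ^+ 4 = 9 / 16 /\ s ^+ 4 * C = 9 / 16 * C /\
   s ^+ 4 * C ^+ 2 = 9 / 16 * C ^+ 2 /\
   s ^+ 4 * C ^+ 3 = 9 / 16 * C ^+ 3 /\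
   s ^+ 4 * C ^+ 4 = 9 / 16 * C ^+ 4) /\
  (s * C ^+ 3 = s * ((6 * C + 1) / 8) /\
   s * C ^+ 4 = s * ((6 * C ^+ 2 + C) / 8)).
Proof.
have C3 : C ^+ 3 = (6 * C + 1) / 8 by have := cos_pi_ninth R; rewrite -/C; lra.
have C4 : C ^+ 4 = (6 * C ^+ 2 + C) / 8 by rewrite exprS C3; field.
have s2 : s ^+ 2 = 3 / 4 by exact: sin_pi_third_sqr.
have s3 : s ^+ 3 = 3 / 4 * s by rewrite exprS s2 mulrC.
have s4 : s ^+ 4 = 9 / 16 by rewrite (exprM s 2 2) s2; field.
by rewrite -C3 -C4 s2 s3 s4 -!mulrA.
Qed.

Lemma tau_unit : tau * tau^*%R = 1.
Proof.
move: monomial_reduction => mr; rewrite /tau conjCE.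
by apply/eqP; rewrite eq_complex /=; apply/andP; split; apply/eqP; lra.
Qed.

Lemma weights_unit_norm :
  2 * wp ^+ 2 + 4 * (wq * wq^*%R) + 2 * wp * (wq + wq^*%R)
  + (wq^*%R ^+ 2 * tau + wq ^+ 2 * tau^*%R) = 1.
Proof.
move: monomial_reduction => mr; rewrite /wp /wq /tau !conjCE.
(* Numerals become embedded reals so that real and imaginary parts reduce by computation. *)
have -> : 2 = 2%:C :> R[i] by rewrite rmorph_nat.
have -> : 4 = 4%:C :> R[i] by rewrite rmorph_nat.
rewrite !expr2 /real_complex_def.
apply/eqP; rewrite eq_complex /=; apply/andP; split; apply/eqP; lra.
Qed.

Lemma weights_orthogonality :
  wp ^+ 2 + 4 * (wp * wq^*%R) + 2 * (wq * wq^*%R) + wq^*%R ^+ 2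
  + 2 * (wp * wq * tau^*%R) + 2 * (wq ^+ 2 * tau^*%R) = 0.
Proof.
move: monomial_reduction => mr; rewrite /wp /wq /tau !conjCE.
have -> : 2 = 2%:C :> R[i] by rewrite rmorph_nat.
have -> : 4 = 4%:C :> R[i] by rewrite rmorph_nat.
rewrite !expr2 /real_complex_def.
apply/eqP; rewrite eq_complex /=; apply/andP; split; apply/eqP; lra.
Qed.

(** The left-hand side is [n0 ^+ 2]; three times it is the bound on the functional. *)
Lemma weights_overlap : (2 * wp + wq + wq^*%R) ^+ 2 = (8 * (1 + C) / 9)%:C.
Proof.
move: monomial_reduction => mr; rewrite /wp /wq /tau !conjCE.
have -> : 2 = 2%:C :> R[i] by rewrite rmorph_nat.
rewrite !expr2 /real_complex_def.
apply/eqP; rewrite eq_complex /=; apply/andP; split; apply/eqP; lra.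
Qed.

(** Parseval for x_0 gives 2 = n0^2 + 2 |n1|^2, so the inequality says n0^2 >= 4/3, that is, cos (pi
    / 9) >= 1/2. *)
Lemma weights_dominance :
  4 * ((wp + wq * tau^*%R + 2 * wq^*%R) * (wp + wq * tau^*%R + 2 * wq^*%R)^*%R)
  <= (2 * wp + wq + wq^*%R) ^+ 2.
Proof.
have := cos_pi_ninth_ge_half R; rewrite -/C => C2.
rewrite weights_overlap; move: monomial_reduction => mr; rewrite /wp /wq /tau !conjCE.
have -> : 2 = 2%:C :> R[i] by rewrite rmorph_nat.
have -> : 4 = 4%:C :> R[i] by rewrite rmorph_nat.
rewrite /real_complex_def.
rewrite lecE /=; apply/andP; split; first by apply/eqP; lra.
lra.
Qed.

End Weights.

(** * The Hesse vectors over Z[omega] *)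

(* The pair (m, n) of integers stands for m + n * omega. *)
Definition eis : Type := (int * int)%type.

Definition eadd (x y : eis) : eis := (x.1 + y.1, x.2 + y.2).
(** Products and conjugates are reduced by omega^2 = conj omega = -1 - omega. *)
Definition emul (x y : eis) : eis :=
  (x.1 * y.1 - x.2 * y.2, x.1 * y.2 + x.2 * y.1 - x.2 * y.2).
Definition econj (x : eis) : eis := (x.1 - x.2, - x.2).
Definition esum (T : Type) (r : seq T) (f : T -> eis) : eis :=
  foldr (fun b => eadd (f b)) (0, 0) r.

(** The factor 1 / sqrt 2 is left out to stay in Z[omega]; (-1, -1) stands for omega^2. *)
Definition hesse_eis (i a : nat) : eis :=
  nth (0, 0) (nth [::]
    [:: [:: (0, 0); (0, 0); (0, 0); (-1, 0); (1, 1); (0, -1); (1, 0); (0, 1); (-1, -1)];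
        [:: (1, 0); (0, 1); (-1, -1); (0, 0); (0, 0); (0, 0); (-1, 0); (1, 1); (0, -1)];
        [:: (-1, 0); (1, 1); (0, -1); (1, 0); (0, 1); (-1, -1); (0, 0); (0, 0); (0, 0)]
    ] i) a.

Definition gram_eis (a b : nat) : eis :=
  esum (iota 0 3) (fun i => emul (econj (hesse_eis i a)) (hesse_eis i b)).

(** The Bargmann invariant: it does not change when the vectors are multiplied by phases. *)
Definition bargmann (a b c : nat) : eis :=
  emul (emul (gram_eis a b) (gram_eis b c)) (gram_eis c a).

(* (1, 1) stands for 1 + omega = - omega ^+ 2 = exp (i pi / 3). *)
Definition positive_triple (a b c : nat) : bool := bargmann a b c == (1, 1).

(** Reduces statements about all outcomes to Boolean tests that [vm_compute] can run. *)
Lemma all_iotaP n (P : pred nat) : all P (iota 0 n) -> forall i : 'I_n, P i.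
Proof. by move=> /allP Pn i; apply: Pn; rewrite mem_iota /=. Qed.

Lemma all_iota2P n (P : nat -> pred nat) :
  all (fun a => all (P a) (iota 0 n)) (iota 0 n) -> forall a b : 'I_n, P a b.
Proof. by move=> /all_iotaP Pn a; apply/all_iotaP/Pn. Qed.

Lemma all_iota3P n (P : nat -> nat -> pred nat) :
  all (fun a => all (fun b => all (P a b) (iota 0 n)) (iota 0 n)) (iota 0 n) ->
  forall a b c : 'I_n, P a b c.
Proof. by move=> /all_iota2P Pn a b; apply/all_iotaP/Pn. Qed.

Lemma gram_eis_diag (a : 'I_9) : gram_eis a a = (2, 0).
Proof.
by apply/eqP; move: a; apply: (@all_iotaP 9 (fun a => gram_eis a a == (2, 0)));
  vm_compute.
Qed.

Lemma gram_eis_offdiag (a b : 'I_9) :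
  a != b -> emul (gram_eis a b) (gram_eis b a) = (1, 0).
Proof.
move=> ab; apply/eqP; move: a b ab.
suff H (a b : 'I_9) :
    ((a : nat) == b) || (emul (gram_eis a b) (gram_eis b a) == (1, 0)).
  by move=> a b /negPf ab; move: (H a b); rewrite [(_ : nat) == _]ab.
move: a b; apply: (@all_iota2P 9 (fun a b =>
  (a == b) || (emul (gram_eis a b) (gram_eis b a) == (1, 0)))); by vm_compute.
Qed.

Lemma bargmann_cases (a b c : 'I_9) : a != b -> b != c -> c != a ->
  [|| bargmann a b c == (-1, 0), positive_triple a b c | positive_triple a c b].
Proof.
suff H : [|| (a : nat) == b, (b : nat) == c, (c : nat) == a,
     bargmann a b c == (-1, 0), positive_triple a b c | positive_triple a c b].
  by move=> /negPf ab /negPf bc /negPf ca; move: H;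
    rewrite ![(_ : nat) == _](ab, bc, ca).
move: a b c; apply: (@all_iota3P 9 (fun a b c => [|| a == b, b == c, c == a,
  bargmann a b c == (-1, 0), positive_triple a b c | positive_triple a c b]));
  by vm_compute.
Qed.

Lemma positive_triple_rot (a b c : 'I_9) :
  positive_triple a b c = positive_triple b c a.
Proof.
have chk : all (fun a => all (fun b => all (fun c =>
    positive_triple a b c == positive_triple b c a) (iota 0 9)) (iota 0 9)) (iota 0 9).
  by vm_compute.
exact: eqP (all_iota3P chk a b c).
Qed.

(** With a repeated index the triple product is a positive integer, 2 or 8. *)
Lemma positive_triple_uniq (a b c : 'I_9) :
  positive_triple a b c -> [&& a != b, b != c & c != a].
Proof.
apply/implyP; rewrite -!(inj_eq val_inj) /=.
move: a b c; apply: (@all_iota3P 9 (fun a b c =>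
  positive_triple a b c ==> [&& a != b, b != c & c != a])); by vm_compute.
Qed.

Definition positive_pairs (x : nat) : seq (nat * nat) :=
  [seq bc <- [seq (b, c) | b <- iota 0 9, c <- iota 0 9] | positive_triple x bc.1 bc.2].

(* Entry (k, l) of the sum, over the positive triples (x, b, c), of |z_i><z_j|, where
   z = (g_xx h_x, g_bx h_b, g_cx h_c). *)
Definition aligned_sum (i j x k l : nat) (r : seq (nat * nat)) : eis :=
  esum r (fun bc => let u := nth 0%N [:: x; bc.1; bc.2] i in
    let v := nth 0%N [:: x; bc.1; bc.2] j in
    emul (emul (gram_eis u x) (hesse_eis k u))
         (econj (emul (gram_eis v x) (hesse_eis l v)))).

(** [design_u] holds the coefficients of |h_x><h_x| and [design_v] those of the identity in the sums
    over positive triples. For instance 96 = 24 * 4: there are 24 pairs, and g_xx = 2. *)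
Definition design_u (i j : nat) : eis :=
  nth (0, 0) (nth [::] [:: [:: (96, 0); (24, 0); (24, 0)];
                           [:: (24, 0); (-3, 0); (9, 6)];
                           [:: (24, 0); (3, -6); (-3, 0)]] i) j.

Definition design_v (i j : nat) : eis :=
  nth (0, 0) (nth [::] [:: [:: (0, 0); (0, 0); (0, 0)];
                           [:: (0, 0); (18, 0); (-6, -12)];
                           [:: (0, 0); (6, 12); (18, 0)]] i) j.

Lemma aligned_sumE (i j : 'I_3) (x : 'I_9) (k l : 'I_3) :
  aligned_sum i j x k l (positive_pairs x) =
  eadd (emul (design_u i j) (emul (hesse_eis k x) (econj (hesse_eis l x))))
       (if k == l then design_v i j else (0, 0)).
Proof.
(* The list of positive pairs is shared, so it is computed once for each [x]. *)
have chk : all (fun x => let r := positive_pairs x in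
    all (fun i => all (fun j => all (fun k => all (fun l =>
      aligned_sum i j x k l r ==
      eadd (emul (design_u i j) (emul (hesse_eis k x) (econj (hesse_eis l x))))
           (if k == l then design_v i j else (0, 0)))
    (iota 0 3)) (iota 0 3)) (iota 0 3)) (iota 0 3)) (iota 0 9).
  by vm_compute.
have /all_iota2P/(_ i j)/all_iota2P/(_ k l)/eqP := all_iotaP chk x.
exact.
Qed.

Section HesseVectors.
Local Open Scope sesquilinear_scope.
Variable R : realType.
Local Notation w := (omega R).

(** A ring homomorphism compatible with conjugation, which carries the integer computations over to
    the complex numbers. *)
Definition ev (x : eis) : R[i] := x.1%:~R + x.2%:~R * w.

Lemma omegaE : w = Complex (- (1 / 2)) (sin (pi / 3)).
Proof.
rewrite /omega; have -> : 2 * pi / 3 = pi - pi / 3 :> R by field.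
by rewrite cosB sinB cospi sinpi cos_pi_third !mul0r addr0 mulN1r sub0r mulN1r opprK.
Qed.

Lemma omega_sqr : w ^+ 2 = - 1 - w.
Proof.
have s2 := sin_pi_third_sqr R; rewrite omegaE expr2.
by apply/eqP; rewrite eq_complex /=; apply/andP; split; apply/eqP; lra.
Qed.

Lemma conj_omega : w^* = -1 - w.
Proof.
rewrite omegaE conjCE.
by apply/eqP; rewrite eq_complex /=; apply/andP; split; apply/eqP; lra.
Qed.

Lemma tauE : ev (1, 1) = tau R.
Proof.
rewrite /ev /= mulr1z mul1r omegaE.
by apply/eqP; rewrite eq_complex /=; apply/andP; split; apply/eqP; lra.
Qed.

Lemma ev_int (n : int) : ev (n, 0) = n%:~R.
Proof. by rewrite /ev mul0r addr0. Qed.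

Lemma ev_add x y : ev (eadd x y) = ev x + ev y.
Proof. by rewrite /ev /= !rmorphD /=; ring. Qed.

Lemma ev_mul x y : ev (emul x y) = ev x * ev y.
Proof.
(* Subtracting a multiple of the relation of omega leaves a polynomial identity. *)
transitivity (ev x * ev y - x.2%:~R * y.2%:~R * (w ^+ 2 - (- 1 - w))).
  by rewrite /ev /= !(rmorphD, rmorphM, rmorphN) /=; ring.
by rewrite omega_sqr subrr mulr0 subr0.
Qed.

Lemma ev_conj x : ev (econj x) = (ev x)^*.
Proof.
rewrite /ev [RHS]rmorphD [X in _ = _ + X]rmorphM /= conj_omega !rmorph_int.
by rewrite rmorphB rmorphN /=; ring.
Qed.

Lemma ev_esum (T : Type) (r : seq T) (f : T -> eis) :
  ev (esum r f) = \sum_(b <- r) ev (f b).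
Proof.
elim: r => [|b r IH]; first by rewrite big_nil ev_int.
by rewrite big_cons -IH -ev_add.
Qed.

Lemma ev_esum_iota n (f : nat -> eis) : ev (esum (iota 0 n) f) = \sum_(b < n) ev (f b).
Proof. by rewrite ev_esum -[n in iota 0 n]subn0 big_mkord. Qed.

Lemma ev_esum_positive_pairs x (f : nat * nat -> eis) :
  ev (esum (positive_pairs x) f)
  = \sum_(b < 9) \sum_(c < 9 | positive_triple x b c) ev (f (val b, val c)).
Proof.
have iota_ord (F : nat -> R[i]) : \sum_(b <- iota 0 9) F b = \sum_(b < 9) F b.
  by rewrite -(big_mkord xpredT).
rewrite ev_esum big_filter big_mkcond big_allpairs_dep iota_ord.
by apply: eq_bigr => b _; rewrite iota_ord [RHS]big_mkcond.
Qed.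

Definition hcol (a : 'I_9) : 'cV[R[i]]_3 := col a (hesse_mx R).

Lemma hcolE a i : hcol a i 0 = ev (hesse_eis i a).
Proof.
rewrite !mxE; have w2 := omega_sqr.
case: i => [[|[|[|//]]] i3]; case: a => [[|[|[|[|[|[|[|[|[|//]]]]]]]]] a9] /=;
  rewrite /ev /= ?w2; by ring.
Qed.

Lemma hesseE a : hesse R a = 6^-1 *: outer (hcol a) (hcol a).
Proof.
rewrite /hesse -[_ *m _]/(outer _ _) /hesse_vec outerZ scalerA -/(hcol a).
congr (_ *: _); rewrite real_conjC -rmorphM /= -expr2 exprVn sqr_sqrtr ?ler0n //.
by rewrite fmorphV rmorph_nat -invfM -natrM.
Qed.

Lemma ip_hcol a b : ip (hcol a) (hcol b) = ev (gram_eis a b).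
Proof.
rewrite ipE ev_esum_iota; apply: eq_bigr => i _.
by rewrite !hcolE ev_mul ev_conj.
Qed.

Lemma ip_hcol_diag a : ip (hcol a) (hcol a) = 2.
Proof. by rewrite ip_hcol gram_eis_diag ev_int. Qed.

Lemma ip_hcol_offdiag a b : a != b ->
  ip (hcol a) (hcol b) * ip (hcol b) (hcol a) = 1.
Proof. by move=> ab; rewrite !ip_hcol -ev_mul gram_eis_offdiag // ev_int. Qed.

Lemma ip_hcol_bargmann a b c :
  ip (hcol a) (hcol b) * ip (hcol b) (hcol c) * ip (hcol c) (hcol a)
  = ev (bargmann a b c).
Proof. by rewrite !ip_hcol -!ev_mul. Qed.

(** For distinct outcomes the scalar is the phase that makes the inner product with h_x equal to 1;
    at index 0 it is 2. *)
Definition aligned_vec (x b c : 'I_9) (i : 'I_3) : 'cV[R[i]]_3 :=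
  let u := nth x [:: x; b; c] i in ip (hcol u) (hcol x) *: hcol u.

Lemma aligned_vecE (x b c : 'I_9) (i k : 'I_3) :
  aligned_vec x b c i k 0 = let u := nth 0%N [:: val x; val b; val c] i in
    ev (emul (gram_eis u x) (hesse_eis k u)).
Proof.
rewrite /aligned_vec mxE ip_hcol hcolE -ev_mul.
by case: i => [[|[|[|//]]] i3].
Qed.

Lemma sum_outer_aligned_vec (i j : 'I_3) (x : 'I_9) :
  \sum_(b < 9) \sum_(c < 9 | positive_triple x b c)
     outer (aligned_vec x b c i) (aligned_vec x b c j)
  = ev (design_u i j) *: outer (hcol x) (hcol x) + (ev (design_v i j))%:M.
Proof.
apply/matrixP => k l; transitivity (ev (aligned_sum i j x k l (positive_pairs x))).
  rewrite summxE ev_esum_positive_pairs; apply: eq_bigr => b _.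
  rewrite summxE; apply: eq_bigr => c _.
  by rewrite outerE !aligned_vecE -ev_conj -ev_mul.
rewrite aligned_sumE ev_add !ev_mul ev_conj -!hcolE [RHS]mxE; congr (_ + _).
  by rewrite [RHS]mxE outerE.
by rewrite [RHS]mxE; case: (k == l); rewrite ?mulr1n ?mulr0n ?ev_int.
Qed.

End HesseVectors.

(** * The upper bound *)

Section UpperBound.
Local Open Scope sesquilinear_scope.
Local Open Scope complex_scope.
Variable R : realType.
Let C : R := cos (pi / 9).
Implicit Types a b c : 'I_9.

Let g a b : R[i] := ip (hcol R a) (hcol R b).

Let g_unit a b : a != b -> g b a * g a b = 1.
Proof. by move=> ab; rewrite mulrC; apply: ip_hcol_offdiag. Qed.

(* The phases make the Gram matrix depend on the triple product only. *)
Definition aligned a b c : seq 'cV[R[i]]_3 :=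
  [:: hcol R a; ip (hcol R b) (hcol R a) *: hcol R b;
      ip (hcol R c) (hcol R a) *: hcol R c].

Lemma aligned_gram a b c : a != b -> b != c -> c != a ->
  let x i := nth 0 (aligned a b c) i in
  [/\ ip (x 0%N) (x 0%N) = 2, ip (x 1%N) (x 1%N) = 2 & ip (x 2%N) (x 2%N) = 2] /\
  [/\ ip (x 0%N) (x 1%N) = 1, ip (x 0%N) (x 2%N) = 1
    & ip (x 1%N) (x 2%N) = ev R (bargmann a b c)].
Proof.
move=> ab bc ca /=; rewrite !(ipZl, ipZr) !ip_hcol_diag !ipC.
have ac : a != c by rewrite eq_sym.
split; split=> //.
- by rewrite mulrA -/(g _ _) -/(g _ _) [g a b * _]mulrC g_unit // mul1r.
- by rewrite mulrA -/(g _ _) -/(g _ _) [g a c * _]mulrC g_unit // mul1r.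
- exact: g_unit.
- exact: g_unit.
- by rewrite -ip_hcol_bargmann; ring.
Qed.

Definition hesse_bound : R[i] := (8 * (1 + C) / 3)%:C.

(** The values <x|P x> are insensitive to phases. *)
Lemma ip_aligned a b c (P : 'I_3 -> 'M[R[i]]_3) : a != b -> c != a ->
  \sum_(i < 3) ip (nth 0 (aligned a b c) i) (P i *m nth 0 (aligned a b c) i)
  = ip (hcol R a) (P 0 *m hcol R a) + ip (hcol R b) (P 1 *m hcol R b)
    + ip (hcol R c) (P 2 *m hcol R c).
Proof.
move=> ab ca; have ac : a != c by rewrite eq_sym.
rewrite big_ord3 /= -!scalemxAr !(ipZl, ipZr) !ipC !mulrA.
by rewrite -/(g a b) -/(g b a) -/(g a c) -/(g c a) ![g a _ * _]mulrC !g_unit // !mul1r.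
Qed.

Lemma positive_bound a b c (P : 'I_3 -> 'M[R[i]]_3) : positive_triple a b c ->
  (forall i, P i ^t* = P i) -> (forall i, P i *m P i = P i) ->
  \sum_i P i = 1%:M ->
  ip (hcol R a) (P 0 *m hcol R a) + ip (hcol R b) (P 1 *m hcol R b)
    + ip (hcol R c) (P 2 *m hcol R c) <= hesse_bound.
Proof.
move=> pos Ph Pi P1; have /and3P[ab bc ca] := positive_triple_uniq pos.
rewrite -(ip_aligned P ab ca).
have [[x00 x11 x22] [x01 x02 x12]] := aligned_gram ab bc ca.
have tauE' : ev R (bargmann a b c) = tau R by rewrite -tauE; congr ev; apply/eqP.
rewrite tauE' in x12.
have := triple_bound (wpR R) (tau_unit R) (weights_unit_norm R)
  (weights_orthogonality R) (weights_dominance R) x00 x11 x22 x01 x02 x12 Ph Pi P1.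
rewrite weights_overlap -/C => /le_trans; apply.
have -> : 3 = 3%:C :> R[i] by rewrite rmorph_nat.
by rewrite -rmorphM lecR; lra.
Qed.

Lemma collinear_bound a b c (P : 'I_3 -> 'M[R[i]]_3) : a != b -> b != c -> c != a ->
  bargmann a b c = (-1, 0) ->
  (forall i, P i ^t* = P i) -> (forall i, P i *m P i = P i) ->
  \sum_i P i = 1%:M ->
  ip (hcol R a) (P 0 *m hcol R a) + ip (hcol R b) (P 1 *m hcol R b)
    + ip (hcol R c) (P 2 *m hcol R c) <= hesse_bound.
Proof.
move=> ab bc ca col Ph Pi P1; rewrite -(ip_aligned P ab ca).
have [[x00 x11 x22] [x01 x02 x12]] := aligned_gram ab bc ca.
rewrite col ev_int in x12.
have := dependent_bound x00 x11 x22 x01 x02 x12 Ph Pi P1.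
move=> /le_trans; apply.
(* 4 <= 8 (1 + C) / 3 amounts to C >= 1/2. *)
have -> : 4 = 4%:C :> R[i] by rewrite rmorph_nat.
by have := cos_pi_ninth_ge_half R; rewrite lecR -/C; lra.
Qed.

Lemma projective_bound (P : 'I_9 -> 'M[R[i]]_3) : projective_measurement P ->
  \sum_a ip (hcol R a) (P a *m hcol R a) <= hesse_bound.
Proof.
move=> PM; have [[_ P1] Pproj] := PM.
have Ph a : (P a) ^t* = P a by apply/hermsymmxP; have [] := Pproj a.
have Pi a : P a *m P a = P a by have [] := Pproj a.
(* Three outcomes carry the whole measurement; [f] enumerates them. *)
have [|f injf fP] := @cover_by_injection 9 3 [set a | P a != 0].
  by apply/andP; split=> //; apply: card_outcomes_projective.
have P0 a : a \notin codom f -> P a = 0.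
  move=> af; apply/eqP; apply: contraNT af => Pa; apply: fP.
  by rewrite inE.
have Pf1 : \sum_i P (f i) = 1%:M by rewrite -P1 (sum_codom injf).
rewrite (sum_codom injf) => [|a /P0 ->]; last by rewrite mul0mx /ip mulmx0 mxE.
rewrite big_ord3.
have fneq i j : i != j -> f i != f j by move=> ij; rewrite (inj_eq injf).
have /or3P[/eqP col|pos|pos] := bargmann_cases (fneq 0 1 isT) (fneq 1 2 isT) (fneq 2 0 isT).
- exact: (@collinear_bound _ _ _ (P \o f) (fneq 0 1 isT) (fneq 1 2 isT)
    (fneq 2 0 isT) col (fun i => Ph _) (fun i => Pi _) Pf1).
- exact: (@positive_bound _ _ _ (P \o f) pos (fun i => Ph _) (fun i => Pi _) Pf1).
(* The triple is negatively oriented, so its last two outcomes are exchanged. *)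
have := @positive_bound _ _ _ (fun i => P (f (nth 0 [:: 0; 2; 1] i))) pos.
rewrite /= addrAC; apply=> //.
by move: Pf1; rewrite !big_ord3 /= addrAC.
Qed.

(** Here <h_a|E_a h_a> = 4/6, tr E_a = 1/3 and <h_a|h_a> = 2. *)
Lemma ip_depolarise_hesse (v : R) a :
  ip (hcol R a) (depolarise v (hesse R a) *m hcol R a) = ((2 + 4 * v) / 9)%:C.
Proof.
rewrite /depolarise hesseE scalerA mulmxDl ipDr -scalemxAl ipZr ip_mulmx_outer.
rewrite mul_scalar_mx ipZr mxtraceZ mxtrace_outer !ip_hcol_diag.
rewrite !(rmorphD, rmorphM, rmorphN, rmorph1, fmorphV, rmorph_nat) /=.
by field.
Qed.

Lemma simulable_le (v : R) :
  projectively_simulable (fun a => depolarise v (hesse R a)) ->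
  v <= (1 + 4 * C) / 6.
Proof.
move=> [N [q [P [q0 q1 PM EE]]]].
have : \sum_a ip (hcol R a) (depolarise v (hesse R a) *m hcol R a) <= hesse_bound.
  rewrite (eq_bigr (fun a => \sum_l (q l)%:C * ip (hcol R a) (P l a *m hcol R a))).
    rewrite exchange_big /= -[hesse_bound]mul1r.
    have -> : 1 = \sum_l (q l)%:C :> R[i] by rewrite -rmorph_sum /= q1.
    rewrite mulr_suml; apply: ler_sum => l _.
    by rewrite -mulr_sumr ler_wpM2l ?ler0c // projective_bound.
  move=> a _; rewrite EE mulmx_suml /ip mulmx_sumr summxE; apply: eq_bigr => l _.
  by rewrite -scalemxAl -scalemxAr mxE.
(* The nine equal terms give 2 + 4 v <= 8 (1 + C) / 3. *)
rewrite (eq_bigr _ (fun a _ => ip_depolarise_hesse v a)) sumr_const card_ord.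
by rewrite -rmorphMn /= lecR; lra.
Qed.

End UpperBound.

(** * The optimal mixture *)

Definition rot3 (T : Type) (t : T * T * T) : T * T * T :=
  let: (a, b, c) := t in (b, c, a).

Lemma big_triple (V : nmodType) (T : finType) (G : T * T * T -> V) :
  \sum_t G t = \sum_a \sum_b \sum_c G (a, b, c).
Proof.
under [RHS]eq_bigr => a _ do rewrite (pair_bigA _ (fun b c => G (a, b, c))).
rewrite (pair_bigA _ (fun a bc => G (a, bc.1, bc.2))) /=.
rewrite (reindex (fun t : T * (T * T) => (t.1, t.2.1, t.2.2))) //=.
by exists (fun t : T * T * T => (t.1.1, (t.1.2, t.2))) => [[a [b c]]|[[a b] c]].
Qed.

Lemma big_rot3 (V : nmodType) (T : finType) (G : T * T * T -> V) :
  \sum_t G (rot3 t) = \sum_t G t.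
Proof.
rewrite [RHS](reindex_inj (h := @rot3 T)) //.
apply: (@can_inj _ _ _ (fun t => rot3 (rot3 t))).
by case=> [[a b] c].
Qed.

Lemma big_orbit3 (V : nmodType) (T : finType) (G : T * T * T -> V) :
  \sum_t G t + \sum_t G (rot3 t) + \sum_t G (rot3 (rot3 t)) = (\sum_t G t) *+ 3.
Proof. by rewrite (big_rot3 (fun t => G (rot3 t))) big_rot3 !mulrS addr0 addrA. Qed.

Section Simulation.
Local Open Scope sesquilinear_scope.
Local Open Scope complex_scope.
Variable R : realType.
Let C : R := cos (pi / 9).
Let p := wp R.
Let q := wq R.
Implicit Types a b c x : 'I_9.

Let h := hcol R.
Let g a b : R[i] := ip (h a) (h b).

(** The first basis vector of the triple; the other two are, up to phase, those of the rotated
    triples. *)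
Definition hvec (t : 'I_9 * 'I_9 * 'I_9) : 'cV[R[i]]_3 :=
  let: (a, b, c) := t in
  comb3 p q q^*%R (h a) (g b a *: h b) (g c a *: h c).

Definition hproj t : 'M[R[i]]_3 := outer (hvec t) (hvec t).

Definition pos3 (t : 'I_9 * 'I_9 * 'I_9) : bool :=
  let: (a, b, c) := t in positive_triple a b c.

Lemma pos3_rot t : pos3 (rot3 t) = pos3 t.
Proof. by case: t => [[a b] c]; rewrite /= [RHS]positive_triple_rot. Qed.

Let basis3 a b c := triple_basis p q (tau R) (h a) (g b a *: h b) (g c a *: h c).

Lemma basis3_orthonormal a b c : positive_triple a b c ->
  forall i j, ip (basis3 a b c i) (basis3 a b c j) = (i == j)%:R.
Proof.
move=> pos; have /and3P[ab bc ca] := positive_triple_uniq pos.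
have [[x00 x11 x22] [x01 x02 x12]] := aligned_gram R ab bc ca.
have tauE' : ev R (bargmann a b c) = tau R by rewrite -tauE; congr ev; apply/eqP.
rewrite tauE' in x12.
have ON := triple_basis_orthonormal (wpR R) (tau_unit R) (weights_unit_norm R)
  (weights_orthogonality R) x00 x11 x22 x01 x02 x12.
by move=> i j; apply: ON.
Qed.

Lemma outer_basis3 a b c : positive_triple a b c ->
  [/\ outer (basis3 a b c 0) (basis3 a b c 0) = hproj (a, b, c),
      outer (basis3 a b c 1) (basis3 a b c 1) = hproj (b, c, a)
    & outer (basis3 a b c 2) (basis3 a b c 2) = hproj (c, a, b)].
Proof.
move=> pos; have /and3P[ab bc ca] := positive_triple_uniq pos.
have gg u v : u != v -> g u v * (g u v)^*%R = 1.
  by move=> uv; rewrite /g ipC; apply: ip_hcol_offdiag.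
have gC u v : g u v = (g v u)^*%R by rewrite /g ipC.
have tE : tau R = g a b * g b c * g c a.
  by rewrite /g ip_hcol_bargmann -tauE; congr ev; apply/esym/eqP.
rewrite /basis3 /hproj /hvec tE [g b a]gC [g c b]gC [g a c]gC.
have E1 := triple_basis_rot1 p q (g b c) (h a) (h b) (h c) (gg _ _ ab) (gg _ _ ca).
have E2 := triple_basis_rot2 p q (g b c) (h a) (h b) (h c) (gg _ _ ab) (gg _ _ ca).
by split; [reflexivity | refine E1 | refine E2].
Qed.

(** The other triples receive a trivial measurement, all on outcome 0, and will have weight 0. *)
Let triple_measurement (t : 'I_9 * 'I_9 * 'I_9) : 'I_9 -> 'M[R[i]]_3 :=
  let: (a, b, c) := t in
  if positive_triple a b c
  then basis_measurement (basis3 a b c) (fun i => nth 0 [:: a; b; c] i)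
  else basis_measurement (fun i => delta_mx i 0) (fun=> 0).

Lemma triple_measurementP t : projective_measurement (triple_measurement t).
Proof.
case: t => [[a b] c] /=; case: ifP => [/basis3_orthonormal ON|_].
  exact: basis_measurementP.
apply: basis_measurementP => i j; rewrite ipE (bigD1 i) //= big1 => [|k ki].
  by rewrite !mxE !eqxx rmorph1 mul1r addr0 andbT.
by rewrite !mxE (negPf ki) rmorph0 mul0r.
Qed.

Lemma triple_measurementE t x : pos3 t ->
  triple_measurement t x
  = (t.1.1 == x)%:R *: hproj t + ((rot3 t).1.1 == x)%:R *: hproj (rot3 t)
    + ((rot3 (rot3 t)).1.1 == x)%:R *: hproj (rot3 (rot3 t)).
Proof.
case: t => [[a b] c] pos; rewrite /triple_measurement [positive_triple a b c]pos.
rewrite /basis_measurement big_mkcond big_ord3.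
have ifE (e : bool) (A B : 'M[R[i]]_3) : A = B -> (if e then A else 0) = e%:R *: B.
  by move=> ->; case: e; rewrite ?scale1r ?scale0r.
have [E0 E1 E2] := outer_basis3 pos.
congr (_ + _ + _); apply: ifE; [exact: E0 | exact: E1 | exact: E2].
Qed.

(** Outcome [x] receives a vector from each rotation that starts with [x]; summing over all triples
    makes the three rotations contribute equally, whence the factor 3. *)
Lemma sum_triple_measurement x :
  \sum_(t | pos3 t) triple_measurement t x
  = 3 *: \sum_(b < 9) \sum_(c < 9 | positive_triple x b c) hproj (x, b, c).
Proof.
pose G t := if pos3 t then (t.1.1 == x)%:R *: hproj t else 0.
have -> : \sum_(t | pos3 t) triple_measurement t x
    = \sum_t G t + \sum_t G (rot3 t) + \sum_t G (rot3 (rot3 t)).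
  rewrite -!big_split big_mkcond /=; apply: eq_bigr => t _.
  rewrite /G !pos3_rot; case: ifP => [/triple_measurementE ->|] //.
  by rewrite !addr0.
rewrite (big_orbit3 G) -scaler_nat.
congr (_ *: _); rewrite big_triple (bigD1 x) //= [X in _ + X]big1 => [|a /negPf ax].
  rewrite addr0; apply: eq_bigr => b _; rewrite [RHS]big_mkcond /=.
  by apply: eq_bigr => c _; rewrite /G /= eqxx scale1r.
by apply: big1 => b _; apply: big1 => c _; rewrite /G /= ax scale0r if_same.
Qed.

Lemma card_positive_triples x :
  \sum_(b < 9) \sum_(c < 9 | positive_triple x b c) (1 : R) = 24.
Proof.
(* The cardinality is a sum of ones in Z[omega], so that the evaluation of sums over positive pairs
   applies. *)
have chk : all (fun x : nat => esum (positive_pairs x) (fun=> (1, 0)) == (24, 0)) (iota 0 9).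
  by vm_compute.
have /eqP chkx := all_iotaP chk x.
apply: (@complexI R); rewrite !rmorph_sum rmorph_nat /=.
transitivity (ev R (24, 0)); last by rewrite ev_int.
rewrite -chkx ev_esum_positive_pairs; apply: eq_bigr => b _.
by rewrite rmorph_sum; apply: eq_bigr => c _; rewrite ev_int rmorph1.
Qed.

(* The first entry is halved because g_xx = 2. *)
Let coef (i : 'I_3) : R[i] := nth 0 [:: p / 2; q; q^*%R] i.

Lemma evE (m n : int) : ev R (m, n) = (m%:~R - n%:~R / 2) +i* (n%:~R * sin (pi / 3)).
Proof.
rewrite /ev /= omegaE -!(rmorph_int (@real_complex_def R (Phant R))) /=.
by apply/eqP; rewrite eq_complex /=; apply/andP; split; apply/eqP; ring.
Qed.

(** Expanding [hvec] along the aligned vectors makes these the coefficients of |h_x><h_x| and of the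
    identity in the sum of the projections. The trace agrees: 2 (2 + 8 C) + (20 - 16 C) = 24. *)
Lemma hesse_mixture :
  \sum_i \sum_j coef i * (coef j)^*%R * ev R (design_u i j) = (2 + 8 * C)%:C /\
  \sum_i \sum_j coef i * (coef j)^*%R * ev R (design_v i j) = ((20 - 16 * C) / 3)%:C.
Proof.
have := monomial_reduction R; rewrite -/C => mr.
have c0 : coef 0 = (sin (pi / 3) * (1 + 4 * C) / 9)%:C.
  rewrite /coef /= /p /wp -/C; have -> : 2 = 2%:C :> R[i] by rewrite rmorph_nat.
  by rewrite -fmorphV -rmorphM; congr _%:C; field.
have c1 : coef 1 = wq R by [].
have c2 : coef 2 = (wq R)^*%R by [].
rewrite !big_ord3 c0 c1 c2 conjCK /design_u /design_v /= !evE real_conjC /wq !conjCE -/C.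
rewrite /real_complex_def.
by split; apply/eqP; rewrite eq_complex /=; apply/andP; split; apply/eqP; lra.
Qed.

Lemma hvecE x b c : hvec (x, b, c) = \sum_i coef i *: aligned_vec R x b c i.
Proof.
rewrite big_ord3 /hvec /comb3 /aligned_vec /= ip_hcol_diag !scalerA.
by rewrite divfK ?pnatr_eq0.
Qed.

Lemma outer_sum n (u : 'I_n -> 'cV[R[i]]_3) (k : 'I_n -> R[i]) :
  outer (\sum_i k i *: u i) (\sum_i k i *: u i)
  = \sum_i \sum_j (k i * (k j)^*%R) *: outer (u i) (u j).
Proof.
apply/matrixP => m l; rewrite outerE !summxE rmorph_sum mulr_suml.
apply: eq_bigr => i _; rewrite mulr_sumr summxE; apply: eq_bigr => j _.
by rewrite [RHS]mxE outerE !mxE rmorphM mulrACA.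
Qed.

Lemma sum_hproj x :
  \sum_(b < 9) \sum_(c < 9 | positive_triple x b c) hproj (x, b, c)
  = (2 + 8 * C)%:C *: outer (h x) (h x) + ((20 - 16 * C) / 3)%:C%:M.
Proof.
transitivity (\sum_i \sum_j (coef i * (coef j)^*%R) *: \sum_(b < 9)
    \sum_(c < 9 | positive_triple x b c)
      outer (aligned_vec R x b c i) (aligned_vec R x b c j)).
  under eq_bigr => b _.
    under eq_bigr => c _ do rewrite /hproj hvecE outer_sum.
    rewrite exchange_big /=; under eq_bigr => i _ do rewrite exchange_big /=.
    over.
  rewrite exchange_big /=; apply: eq_bigr => i _.
  rewrite exchange_big /=; apply: eq_bigr => j _.
  by rewrite scaler_sumr; apply: eq_bigr => b _; rewrite scaler_sumr.
have [U V] := hesse_mixture.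
under eq_bigr => i _ do under eq_bigr => j _ do rewrite sum_outer_aligned_vec.
rewrite -U -V; apply/matrixP => k l; rewrite summxE [RHS]mxE.
rewrite [X in _ = X + _]mxE [X in _ = _ + X]mxE.
rewrite mulr_suml -sumrMnl -big_split; apply: eq_bigr => i _ /=.
rewrite summxE mulr_suml -sumrMnl -big_split; apply: eq_bigr => j _ /=.
rewrite [LHS]mxE [X in _ * X]mxE [X in _ * (X + _)]mxE [X in _ * (_ + X)]mxE.
by rewrite mulrDr mulrA mulrnAr.
Qed.

Lemma depolarise_hesse_simulable :
  projectively_simulable (fun a => depolarise ((1 + 4 * C) / 6) (hesse R a)).
Proof.
(* There are 9 * 24 = 216 positive ordered triples. *)
pose wt t : R := if pos3 t then 216^-1 else 0.
apply: (@simulable_finType R 3 _ _ _ wt triple_measurement).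
- by move=> t; rewrite /wt; case: ifP; rewrite ?invr_ge0 ?ler0n.
- rewrite big_triple; transitivity (\sum_(x < 9) (216^-1 * 24 : R)).
    apply: eq_bigr => x _; rewrite -(card_positive_triples x) mulr_sumr.
    apply: eq_bigr => b _; rewrite mulr_sumr [RHS]big_mkcond.
    by apply: eq_bigr => c _; rewrite mulr1.
  by rewrite sumr_const card_ord -mulr_natl; field.
- exact: triple_measurementP.
move=> a; transitivity (216^-1 *: \sum_(t | pos3 t) triple_measurement t a); last first.
  rewrite scaler_sumr big_mkcond; apply: eq_bigr => t _; rewrite /wt.
  by case: ifP => _; rewrite ?scale0r // fmorphV rmorph_nat.
rewrite sum_triple_measurement sum_hproj /depolarise hesseE mxtraceZ mxtrace_outer.
rewrite ip_hcol_diag !scalerDr !scalerA -[h a]/(hcol R a) scale_scalar_mx.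
congr (_ *: _ + _%:M).
  rewrite !(rmorphD, rmorphM, rmorphN, rmorph1, fmorphV, rmorph_nat) /=.
  by field.
rewrite !(rmorphD, rmorphM, rmorphN, rmorph1, fmorphV, rmorph_nat) /=.
by field.
Qed.

End Simulation.

Theorem mainTheorem5 (R : realType) :
  is_projsim_threshold (@hesse R) ((1 + 4 * cos (pi / 9)) / 6).
Proof.
split; last by move=> v [_]; apply: simulable_le.
split; last exact: depolarise_hesse_simulable.
have := cos_pi_ninth_ge_half R; have := cos_le1 (pi / 9 : R); set C := cos _.
by move=> ? ?; apply/andP; split; lra.
Qed.
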